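(* Let $E$ be a countable set with $E_A^\infty$ finitely primitive and let $f\in H_{\gamma,\Omega}(E_A^\infty)$. For every $\omega\in\Omega_{d,f}\cap\Omega_{b,f}$ there exist Borel probability measures $\{\widetilde m^f_{\omega_{k-1}}\}_{k\in\mathbb N}$ on $E_A^\infty$ (a sequence indexed by $k$) such that for all $k\in\mathbb N$ $$\mathcal L_{f,\omega_{k-1}}^*(\widetilde m^f_{\omega_k})=\lambda_f(\omega_{k-1})\,\widetilde m^f_{\omega_{k-1}},\qquad\text{where }\ \lambda_f(\omega_{k-1})=\mathcal L_{f,\omega_{k-1}}^*(\widetilde m^f_{\omega_k})(1).$$
   Context: $E$ is a non-empty countable set, $A:E\times E\to\{0,1\}$, $E_A^\infty=\{\tau\in E^{\mathbb N\cup\{0\}}:A_{\tau_{n-1},\tau_n}=1\ \forall n\ge1\}$ with metric $d(\tau,\tau')=e^{-k}$, $k$ the first index where $\tau,\tau'$ differ (and $d(\tau,\tau)=0$). $E_A^n$ is the set of admissible words of length $n$ (all consecutive letters satisfy $A=1$). $E_A^\infty$ is finitely primitive: there are $N_A\ge1$ and a finite $\Lambda\subset E_A^{N_A}$ such that for all $e,e'\in E$ there is $w\in\Lambda$ with $ewe'$ admissible (standing assumption). $(\Omega,\mathcal F,\mathbb P)$ is a complete probability space and $\theta:\Omega\to\Omega$ is invertible, bimeasurable, $\mathbb P$-preserving and ergodic; $\omega_n:=\theta^n(\omega)$ for $n\in\mathbb Z$. Fix $\gamma>0$. For $g:E_A^\infty\to\mathbb R$ put $v_\gamma(g)=\sup\{|g(\tau)-g(\tau')|/d(\tau,\tau')^\gamma:\tau\ne\tau',\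 \tau_0=\tau'_0\}$. $H_{\gamma,\Omega}(E_A^\infty)$ is the set of $f:E_A^\infty\times\Omega\to\mathbb R$ such that $\omega\mapsto f(\tau,\omega)$ is measurable for each $\tau$, $f_\omega:=f(\cdot,\omega)$ is continuous with $v_\gamma(f_\omega)<\infty$ for every $\omega$, and $v_\gamma(f):=\mathrm{ess\,sup}_\omega v_\gamma(f_\omega)<\infty$. For bounded continuous $g$ on $E_A^\infty$, $\mathcal L_{f,\omega}(g)(\tau)=\sum_{e\in E,\,A_{e,\tau_0}=1}e^{f(e\tau,\omega)}g(e\tau)$, and $M_f(\omega)=\sup_\tau\mathcal L_{f,\omega}(1)(\tau)$. When $M_f(\omega)<\infty$, $\mathcal L_{f,\omega}$ maps the Banach space $C^b(E_A^\infty)$ of bounded continuous functions (sup norm) to itself; $\mathcal L_{f,\omega}^*$ is its dual, so $\mathcal L^*_{f,\omega}(m)(g)=\int\mathcal L_{f,\omega}(g)\,dm$. $\Omega_{d,f}=\bigcap_{k\in\mathbb Z}\theta^k(\{\omega:v_\gamma(f_\omega)\le v_\gamma(f)\})$ and $\Omega_{b,f}=\bigcap_{k\in\mathbb Z}\theta^k(\{\omega:M_f(\omega)<\infty\})$. *)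

(* Defs.v *)
From HB Require Import structures.
From mathcomp Require Import all_boot all_order all_algebra.
From mathcomp Require Import all_classical all_reals all_analysis ess_sup_inf.

Set Implicit Arguments.
Unset Strict Implicit.
Unset Printing Implicit Defensive.

Import Order.TTheory GRing.Theory Num.Theory.
Import numFieldNormedType.Exports.

Local Open Scope classical_set_scope.
Local Open Scope ring_scope.

Definition words (E : countType) (A : rel E) (n : nat) : set (n.-tuple E) :=
  [set w | sorted A w].
Arguments words {E} A n.

Definition finitely_primitive (E : countType) (A : rel E) : Prop :=
  exists2 N : nat, (0 < N)%N &
  exists2 Lambda : set (N.-tuple E),
    finite_set Lambda /\ Lambda `<=` words A N &
    forall e e' : E, exists2 w : N.-tuple E,
      Lambda w & sorted A (e :: rcons w e').

(* The parameter R is used only by the metric, whose values lie in R. *)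
Record shift_space (R : realType) (E : countType) (A : rel E) := ShiftSpace {
  letter :> nat -> E;
  letterP : forall n, A (letter n) (letter n.+1) }.

Section ShiftMetric.
Variables (R : realType) (E : countType) (A : rel E).
Local Notation X := (shift_space R A).
Implicit Types s t u : X.

HB.instance Definition _ := gen_eqMixin X.
HB.instance Definition _ := gen_choiceMixin X.

Definition sdist s t : R :=
  match pselect (exists n, s n != t n) with
  | left h => expR (- (ex_minn h)%:R)
  | right _ => 0
  end.

Lemma shift_eq s t : (forall n, s n = t n) -> s = t.
Proof.
case: s t => [s sP] [t tP] /= /funext st; move: sP tP; rewrite st => sP tP.
by congr ShiftSpace; exact: Prop_irrelevance.
Qed.

Lemma sdist_lt s t k :
  (sdist s t < expR (- k%:R)) <-> (forall n, (n <= k)%N -> s n = t n).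
Proof.
rewrite /sdist; case: pselect => [h|h]; last first.
  split=> [_ n _|_]; last exact: expR_gt0.
  by apply/eqP/negPn/negP => st; apply: h; exists n.
rewrite ltr_expR ltrN2 ltr_nat; case: ex_minnP => m stm mmin; split.
  move=> km n nk; apply/eqP/negPn/negP => /mmin mn.
  by move: km; rewrite ltnNge (leq_trans mn nk).
by move=> st; rewrite ltnNge; apply/negP => /st/eqP; apply/negP.
Qed.

Lemma sdist_cases s t : sdist s t = 0 \/ exists k, sdist s t = expR (- k%:R).
Proof.
by rewrite /sdist; case: pselect => [h|h]; [right; exists (ex_minn h)|left].
Qed.

Lemma sdist_ge0 s t : 0 <= sdist s t.
Proof. by case: (sdist_cases s t) => [->//|[k ->]]; exact: expR_ge0. Qed.

Lemma sdistxx s : sdist s s = 0.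
Proof.
rewrite /sdist; case: pselect => // h; exfalso.
by case: h => n; rewrite eqxx.
Qed.

Lemma sdist_positivity s t : sdist s t = 0 -> s = t.
Proof.
move=> st0; apply: shift_eq => n.
by apply: ((sdist_lt s t n).1 _ n) => //; rewrite st0 expR_gt0.
Qed.

Lemma sdist_sym s t : sdist s t = sdist t s.
Proof.
have le u v : sdist u v <= sdist v u.
  rewrite leNgt; apply/negP => lt_uv.
  case: (sdist_cases u v) => [uv|[k uv]]; rewrite uv in lt_uv.
    by move: lt_uv; rewrite ltNge sdist_ge0.
  have vu := (sdist_lt v u k).1 lt_uv.
  have : sdist u v < expR (- k%:R).
    by apply/sdist_lt => n /vu ->.
  by rewrite uv ltxx.
by apply/eqP; rewrite eq_le !le.
Qed.

Lemma sdist_triangle t s u : sdist s u <= sdist s t + sdist t u.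
Proof.
rewrite leNgt; apply/negP => lt_su.
have st : sdist s t < sdist s u.
  by apply: le_lt_trans lt_su; rewrite lerDl sdist_ge0.
have tu : sdist t u < sdist s u.
  by apply: le_lt_trans lt_su; rewrite lerDr sdist_ge0.
case: (sdist_cases s u) => [su|[k su]]; rewrite su in st tu.
  by move: st; rewrite ltNge sdist_ge0.
have : sdist s u < expR (- k%:R).
  apply/sdist_lt => n nk.
  by rewrite ((sdist_lt s t k).1 st n nk) ((sdist_lt t u k).1 tu n nk).
by rewrite su ltxx.
Qed.

HB.instance Definition _ :=
  isMetric.Build R X sdistxx sdist_positivity sdist_sym sdist_triangle.

End ShiftMetric.

(* Measurable types are pointed, so the Borel space takes the two hypotheses
   under which the shift space is non-empty as arguments. *)
Section BorelShift.
Variables (R : realType) (E : countType) (A : rel E).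

Lemma shift_inhabited (hE : inhabited E) (hA : finitely_primitive A) :
  inhabited (shift_space R A).
Proof.
case: hE hA => e0 [N _ [L _ prim]].
have succ e : exists e', A e e'.
  have [[[|a w] ?] /= _] := prim e e; first by case/andP => ? _; exists e.
  by case/andP => ? _; exists a.
have [next nextP] := choice succ.
by constructor; exists (fun n => iter n next e0) => n; exact: nextP.
Qed.

Definition pshift (hE : inhabited E) (hA : finitely_primitive A) : Type :=
  shift_space R A.

Variables (hE : inhabited E) (hA : finitely_primitive A).

HB.instance Definition _ := Choice.copy (pshift hE hA) (shift_space R A).

Lemma pshift_exists : exists _ : pshift hE hA, True.
Proof. by have [t] := shift_inhabited hE hA; exists t. Qed.

HB.instance Definition _ := isPointed.Build (pshift hE hA)
  (projT1 (cid pshift_exists)).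

Definition borel_shift : Type :=
  g_sigma_algebraType (@open (shift_space R A) : set (set (pshift hE hA))).

End BorelShift.

Section HolderPotentials.
Variables (R : realType) (E : countType) (A : rel E).
Local Notation X := (shift_space R A).

(* 0 is added so that the supremum of the empty family is 0. *)
Definition holder (gamma : R) (g : X -> R) : \bar R :=
  ereal_sup [set x | x = 0%E \/ exists s t : X, [/\ s <> t, s 0%N = t 0%N &
    x = (`|g s - g t| / mdist s t `^ gamma)%:E]].

Definition ess_holder d (Omega : measurableType d) (P : probability Omega R)
    (gamma : R) (f : X -> Omega -> R) : \bar R :=
  ess_sup P (fun w => holder gamma (f^~ w)).

Record holder_potential d (Omega : measurableType d) (P : probability Omega R)
    (gamma : R) (f : X -> Omega -> R) : Prop := HolderPotential {
  potential_measurable : forall t, measurable_fun [set: Omega] (f t);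
  potential_continuous : forall w, continuous (f^~ w);
  potential_holder : forall w, (holder gamma (f^~ w) < +oo)%E;
  potential_ess_holder : (ess_holder P gamma f < +oo)%E }.

End HolderPotentials.

Section TransferOperator.
Variables (R : realType) (E : countType) (A : rel E).
Local Notation X := (shift_space R A).

Definition scons_letter (t : nat -> E) (e : E) (n : nat) : E :=
  if n is n'.+1 then t n' else e.

Lemma scons_letterP (t : X) (e : {e : E | A e (t 0%N)}) n :
  A (scons_letter t (val e) n) (scons_letter t (val e) n.+1).
Proof. by case: n => [|n] /=; [exact: (valP e)|exact: letterP]. Qed.

Definition scons (t : X) (e : {e : E | A e (t 0%N)}) : X :=
  ShiftSpace R (scons_letterP e).

Variable Omega : Type.

(* The value lies in \bar R, so that transfer_sup f w may be +oo. The
   unordered sum is the difference of the sums of its positive and negative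
   parts; these are finite when g is bounded and transfer_sup f w < +oo. *)
Definition transfer (f : X -> Omega -> R) (w : Omega) (g : X -> R) (t : X) :
    \bar R :=
  let h (e : {e : E | A e (t 0%N)}) :=
    (expR (f (scons e) w) * g (scons e))%:E in
  (\esum_(e in setT) h^\+ e - \esum_(e in setT) h^\- e)%E.

Definition transfer_sup (f : X -> Omega -> R) (w : Omega) : \bar R :=
  ereal_sup (range (transfer f w (cst 1))).

Definition transfer_dual (hE : inhabited E) (hA : finitely_primitive A)
    (f : X -> Omega -> R) (w : Omega)
    (m : probability (borel_shift R hE hA) R) (g : X -> R) : \bar R :=
  (\int[m]_t transfer f w g t)%E.

End TransferOperator.

Record ergodic_automorphism d (Omega : measurableType d) (R : realType)
    (P : probability Omega R) (theta : Omega -> Omega) : Prop :=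
  ErgodicAutomorphism {
    automorphism_bij : bijective theta;
    automorphism_measurable : measurable_fun [set: Omega] theta;
    automorphism_bimeasurable : forall B, measurable B ->
      measurable (theta @` B);
    automorphism_preserving : forall B, measurable B ->
      P (theta @^-1` B) = P B;
    automorphism_ergodic : forall B, measurable B ->
      theta @^-1` B = B -> P B = 0%E \/ P B = 1%E }.

(* theta^k(B) for k in Z, theta being a bijection; Negz n is -(n + 1). *)
Definition zimage (Omega : Type) (theta : Omega -> Omega) (k : int)
    (B : set Omega) : set Omega :=
  match k with
  | Posz n => iter n theta @` B
  | Negz n => iter n.+1 theta @^-1` B
  end.

Section GoodFibres.
Variables (R : realType) (E : countType) (A : rel E).
Local Notation X := (shift_space R A).

Definition Omega_d d (Omega : measurableType d) (P : probability Omega R)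
    (theta : Omega -> Omega) (gamma : R) (f : X -> Omega -> R) : set Omega :=
  \bigcap_(k in [set: int]) zimage theta k
    [set w | (holder gamma (f^~ w) <= ess_holder P gamma f)%E].

Definition Omega_b (Omega : Type) (theta : Omega -> Omega)
    (f : X -> Omega -> R) : set Omega :=
  \bigcap_(k in [set: int]) zimage theta k
    [set w | (transfer_sup f w < +oo)%E].

End GoodFibres.

(* Main.v *)
(* Fix omega and write L_k for the transfer operator of the fibre theta^k omega.
   For a base point x0, the functionals g |-> (L_k ... L_(n-1) g)(x0), divided
   by their value at 1, satisfy the wanted relation up to level n; they converge
   along an ultrafilter in n to finitely additive charges.  Finite primitivity
   bounds L_k 1 from below and, as M_f < oo, makes the suprema of the weights
   over the first-letter cylinders summable, so the masses of the cylinders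
   [u i] are dominated by a summable sequence in i, uniformly in n: no mass
   escapes and the limit masses of cylinders are countably additive.  A
   consistent family of cylinder masses is the law of the word coded by nested
   subintervals of [0, 1[, under Lebesgue measure.  Finally the Hoelder bound
   gives m_k([i v]) lambda_k = e^(f(i t)) m_(k+1)([v]) up to a factor tending to
   1 as |v| grows, and a continuous function is a limit of functions of
   finitely many letters. *)
From HB Require Import structures.
Require Import Defs.
From mathcomp Require Import all_boot all_order all_algebra.
From mathcomp Require Import all_classical all_reals all_analysis ess_sup_inf.
From mathcomp Require Import measurable_realfun.

Import Order.TTheory GRing.Theory Num.Theory.
Import numFieldNormedType.Exports.

Local Open Scope classical_set_scope.
Local Open Scope ring_scope.

Set Implicit Arguments.
Unset Strict Implicit.
Unset Printing Implicit Defensive.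

(** * Limits of iterated transfer operators *)

(** The segment is compact, so the image of [U] clusters at some [l]; an ultrafilter contains each
    set or its complement, which turns a cluster point into a limit. *)
Lemma ultra_bounded_cvg (R : realType) (I : Type) (U : set_system I)
    (u : I -> R) (b c : R) :
  UltraFilter U -> (\forall i \near U, b <= u i <= c) ->
  exists l : R, u @ U --> l.
Proof.
move=> UU bu.
have PU : ProperFilter (u @ U) by apply: fmap_proper_filter.
have [|l [_ cl]] := @segment_compact R b c (u @ U) PU.
  by apply: filterS bu => i /=; rewrite in_itv.
exists l => B lB.
have [//|nB] := in_ultra_setVsetC (u @^-1` B) UU.
have [x [nBx Bx]] : (~` B) `&` B !=set0 by apply: cl => //; exact: nB.
by [].
Qed.

Section AbstractTransfer.
Variables (R : realType) (T : Type) (wt : nat -> nat -> T -> R).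
Variable cns : nat -> T -> T.
Hypothesis wt_ge0 : forall k i t, 0 <= wt k i t.
Local Open Scope ereal_scope.
Implicit Types (g h : T -> \bar R) (P Q : T -> bool).

(** Abstract transfer operator of level [k]: [i] runs over codes of letters, and [wt k i t] is meant
    to vanish when [i] codes no letter that may precede [t]. Values in [\bar R] free the algebra
    below from summability conditions. *)
Definition ruelle k g t : \bar R := \sum_(i <oo) (wt k i t)%:E * g (cns i t).

Definition event P t : \bar R := (P t)%:R%:E.

Lemma event_ge0 P t : 0 <= event P t.
Proof. by rewrite lee_fin. Qed.

Lemma ruelle_ge0 k g : (forall t, 0 <= g t) -> forall t, 0 <= ruelle k g t.
Proof.
by move=> g0 t; apply: nneseries_ge0 => i _ _; rewrite mule_ge0// lee_fin.
Qed.

Lemma le_ruelle k g h : (forall t, 0 <= g t) -> (forall t, g t <= h t) ->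
  forall t, ruelle k g t <= ruelle k h t.
Proof.
move=> g0 gh t; apply: lee_nneseries => i; first by rewrite mule_ge0// lee_fin.
by rewrite lee_wpmul2l// lee_fin.
Qed.

Lemma ruelleD k g h : (forall t, 0 <= g t) -> (forall t, 0 <= h t) ->
  ruelle k (g \+ h) = ruelle k g \+ ruelle k h.
Proof.
move=> g0 h0; apply/funext => t; rewrite /ruelle -nneseriesD; first last.
- by move=> i _ _; rewrite mule_ge0// lee_fin.
- by move=> i _ _; rewrite mule_ge0// lee_fin.
by apply: eq_eseriesr => i _; rewrite ge0_muleDr.
Qed.

Lemma ruelleZ k (c : R) g : (forall t, 0 <= g t) ->
  ruelle k (fun t => c%:E * g t) = (fun t => c%:E * ruelle k g t).
Proof.
move=> g0; apply/funext => t; rewrite /ruelle -nneseriesZl.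
  by apply: eq_eseriesr => i _; rewrite muleCA.
by move=> i _; rewrite mule_ge0// lee_fin.
Qed.

Variable x0 : T.

(** The operators of levels [k], ..., [k + j - 1], that of level [k] acting first, followed by
    evaluation at [x0]. *)
Fixpoint iter_ruelle j k g : \bar R :=
  if j is j'.+1 then iter_ruelle j' k.+1 (ruelle k g) else g x0.

Lemma iter_ruelle_ge0 j k g : (forall t, 0 <= g t) -> 0 <= iter_ruelle j k g.
Proof. by elim: j k g => //= j IH k g g0; apply/IH/ruelle_ge0. Qed.

Lemma le_iter_ruelle j k g h : (forall t, 0 <= g t) ->
  (forall t, g t <= h t) -> iter_ruelle j k g <= iter_ruelle j k h.
Proof.
elim: j k g h => //= j IH k g h g0 gh.
by apply: IH; [exact: ruelle_ge0|exact: le_ruelle].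
Qed.

Lemma iter_ruelleD j k g h : (forall t, 0 <= g t) -> (forall t, 0 <= h t) ->
  iter_ruelle j k (g \+ h) = iter_ruelle j k g + iter_ruelle j k h.
Proof.
elim: j k g h => //= j IH k g h g0 h0.
by rewrite ruelleD// IH//; exact: ruelle_ge0.
Qed.

Lemma iter_ruelleZ j k (c : R) g : (forall t, 0 <= g t) ->
  iter_ruelle j k (fun t => c%:E * g t) = c%:E * iter_ruelle j k g.
Proof.
elim: j k g => //= j IH k g g0.
by rewrite ruelleZ// IH//; exact: ruelle_ge0.
Qed.

Variables (b c : nat -> R).
Hypothesis b_gt0 : forall k, (0 < b k)%R.
Hypothesis ruelle_ge : forall k t, (b k)%:E <= ruelle k (event xpredT) t.
Hypothesis ruelle_le : forall k t, ruelle k (event xpredT) t <= (c k)%:E.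

(** Each operator multiplies the value at the constant 1 by at most [c k], so finitely many of them
    keep it finite. *)
Lemma iter_ruelle_event j k P :
  iter_ruelle j k (event P) \is a fin_num.
Proof.
have W0 : 0 <= iter_ruelle j k (event P) by apply/iter_ruelle_ge0/event_ge0.
rewrite ge0_fin_numE//.
apply: (@le_lt_trans _ _ (iter_ruelle j k (event xpredT))).
  apply: le_iter_ruelle => t; first exact: event_ge0.
  by rewrite lee_fin; case: (P t).
elim: j k {W0} => [|j IH] k /=; first by rewrite ltry.
apply: (@le_lt_trans _ _
    (iter_ruelle j k.+1 (fun t => (c k)%:E * event xpredT t))).
  apply: le_iter_ruelle => t; first exact/ruelle_ge0/event_ge0.
  by rewrite /event mule1.
rewrite iter_ruelleZ; last exact: event_ge0.
rewrite lte_mul_pinfty// lee_fin.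
have t := x0; rewrite -lee_fin; apply: le_trans (ruelle_le k t).
exact/ruelle_ge0/event_ge0.
Qed.

Definition mass j k P : R := fine (iter_ruelle j k (event P)).

Lemma mass_ge0 j k P : (0 <= mass j k P)%R.
Proof. by apply/fine_ge0/iter_ruelle_ge0/event_ge0. Qed.

Lemma mass_le_step (C : R) j k P Q :
  (forall t, ruelle k (event P) t <= C%:E * event Q t) ->
  (mass j.+1 k P <= C * mass j k.+1 Q)%R.
Proof.
move=> PQ; rewrite -lee_fin EFinM /mass !fineK ?iter_ruelle_event//=.
rewrite -iter_ruelleZ; last exact: event_ge0.
by apply: le_iter_ruelle => //; exact/ruelle_ge0/event_ge0.
Qed.

Lemma mass_ge_step (C : R) j k P Q : (0 <= C)%R ->
  (forall t, C%:E * event Q t <= ruelle k (event P) t) ->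
  (C * mass j k.+1 Q <= mass j.+1 k P)%R.
Proof.
move=> C0 PQ; rewrite -lee_fin EFinM /mass !fineK ?iter_ruelle_event//=.
rewrite -iter_ruelleZ; last exact: event_ge0.
by apply: le_iter_ruelle => // t; rewrite mule_ge0 ?lee_fin// event_ge0.
Qed.

Lemma massD j k P Q : (forall t, ~~ (P t && Q t)) ->
  mass j k (fun t => P t || Q t) = (mass j k P + mass j k Q)%R.
Proof.
move=> PQ; rewrite /mass -fineD ?iter_ruelle_event//.
rewrite -iter_ruelleD; try exact: event_ge0.
congr (fine (iter_ruelle _ _ _)); apply/funext => t.
rewrite /event/= -EFinD -natrD.
by have := PQ t; case: (P t) (Q t) => [] [].
Qed.

Lemma massT_gt0 j k : (0 < mass j k xpredT)%R.
Proof.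
elim: j k => [|j IH] k; first by rewrite /mass/= ltr01.
apply: (lt_le_trans (mulr_gt0 (b_gt0 k) (IH k.+1))).
by apply: mass_ge_step => [|t]; [exact/ltW|rewrite /event mule1].
Qed.

(* The normalised masses converge along an ultrafilter on the depth of the
   iteration, simultaneously for all events. *)
Lemma conformal_charges :
  exists (al : nat -> (T -> bool) -> R) (lam : nat -> R),
    [/\ (forall k P, 0 <= al k P)%R,
        (forall k, al k xpredT = 1%R),
        (forall k P Q, (forall t, ~~ (P t && Q t)) ->
           al k (fun t => P t || Q t) = al k P + al k Q)%R,
        (forall k, b k <= lam k)%R &
        forall k P Q (C : R), (0 <= C)%R ->
          ((forall t, ruelle k (event P) t <= C%:E * event Q t) ->
            (lam k * al k P <= C * al k.+1 Q)%R) /\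
          ((forall t, C%:E * event Q t <= ruelle k (event P) t) ->
            (C * al k.+1 Q <= lam k * al k P)%R)].
Proof.
have [U [UU oU]] := ultraFilterLemma (F := \oo%classic) _.
have gtk k : \forall n \near U, (k < n)%N by apply: oU; exact: nbhs_infty_gt.
(* With [n - k] operators every level [k] ends at the same level [n], so consecutive levels are
   compatible. For [n < k] the truncated subtraction gives junk values, which [U] ignores. *)
pose a n k P : R := (mass (n - k) k P / mass (n - k) k xpredT)%R.
pose l n k : R := (mass (n - k) k xpredT / mass (n - k.+1) k.+1 xpredT)%R.
have a0 n k P : (0 <= a n k P)%R by rewrite divr_ge0 ?mass_ge0.
have subS k n : (k < n)%N -> (n - k = (n - k.+1).+1)%N.
  by move=> kn; rewrite subnSK.
(* The mass of 1 at level [k] cancels, leaving the denominator of [a n k.+1]; one-step inequalities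
   between masses thus become inequalities between [l * a] at level [k] and [a] at level [k.+1]. *)
have la k n P : (k < n)%N ->
    (l n k * a n k P = mass (n - k) k P / mass (n - k.+1) k.+1 xpredT)%R.
  by move=> kn; rewrite /l /a mulrC mulrA divfK// gt_eqF ?massT_gt0.
(* Level and event form one index, so that a single use of choice selects all the limits. *)
have cvga kP : exists p : R, a n kP.1 kP.2 @[n --> U] --> p.
  apply: (ultra_bounded_cvg (b := 0%R) (c := 1%R)) => //.
  near=> n; rewrite a0/= /a ler_pdivrMr ?massT_gt0// mul1r.
  rewrite /mass fine_le ?iter_ruelle_event//.
  apply: le_iter_ruelle; first exact: event_ge0.
  by move=> t; rewrite lee_fin; case: (kP.2 t).
have cvgl k : exists p : R, l n k @[n --> U] --> p.
  apply: (ultra_bounded_cvg (b := b k) (c := c k)) => //.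
  near=> n; rewrite /l ler_pdivlMr ?massT_gt0// ler_pdivrMr ?massT_gt0//.
  rewrite (subS k n); last first.
    by near: n; exact: gtk.
  apply/andP; split.
    apply: mass_ge_step => [|t]; first exact/ltW.
    by rewrite /event mule1.
  by apply: mass_le_step => t; rewrite /event mule1.
have [al alE] := choice cvga.
have [lam lamE] := choice cvgl.
have laE k P : (l n k * a n k P)%R @[n --> U] --> (lam k * al (k, P))%R.
  by apply: cvgM; [exact: lamE|exact: (alE (k, P))].
exists (fun k P => al (k, P)), lam; split.
- move=> k P; apply: (ler_cvg_to (cvg_cst 0%R) (alE (k, P))).
  by near=> n; exact: a0.
- move=> k; apply: (cvg_unique _ (alE (k, xpredT))) => //=.
  by apply: cvg_near_cst; near=> n; rewrite /a divff// gt_eqF ?massT_gt0.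
- move=> k P Q PQ.
  apply: (cvg_unique _ (alE (k, fun t => P t || Q t))) => //=.
  rewrite (_ : (fun n => _) = (fun n => a n k P + a n k Q)%R).
    by apply: cvgD; [exact: (alE (k, P))|exact: (alE (k, Q))].
  by apply/funext => n; rewrite /a massD// mulrDl.
- move=> k; apply: (ler_cvg_to (cvg_cst (b k)) (lamE k)).
  near=> n; rewrite /l ler_pdivlMr ?massT_gt0// (subS k n); last first.
    by near: n; exact: gtk.
  by apply: mass_ge_step => [|t]; [exact/ltW|rewrite /event mule1].
- move=> k P Q C C0.
  have CQ : (C * a n k.+1 Q)%R @[n --> U] --> (C * al (k.+1, Q))%R.
    by apply: cvgM; [exact: cvg_cst|exact: (alE (k.+1, Q))].
  split => PQ.
    apply: (ler_cvg_to (laE k P) CQ).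
    near=> n; have kn : (k < n)%N by near: n; exact: gtk.
    rewrite la// /a mulrA ler_wpM2r ?invr_ge0 ?mass_ge0// (subS k n)//.
    exact: mass_le_step.
  apply: (ler_cvg_to CQ (laE k P)).
  near=> n; have kn : (k < n)%N by near: n; exact: gtk.
  rewrite la// /a mulrA ler_wpM2r ?invr_ge0 ?mass_ge0// (subS k n)//.
  exact: mass_ge_step.
Unshelve. all: by end_near. Qed.

End AbstractTransfer.

(** * Cylinders and countable additivity of their limit masses *)

Section Cylinders.
Variables (T : Type) (code : T -> nat -> nat).

Definition incyl (u : seq nat) (t : T) : bool := mkseq (code t) (size u) == u.

Lemma incyl_rcons u i t :
  incyl (rcons u i) t = incyl u t && (code t (size u) == i).
Proof. by rewrite /incyl size_rcons mkseqS eqseq_rcons. Qed.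

Lemma incylP u t :
  reflect (forall n, (n < size u)%N -> code t n = nth 0%N u n) (incyl u t).
Proof.
apply: (iffP eqP) => [<- n|tu]; first rewrite size_mkseq => nu.
  by rewrite nth_mkseq.
apply: (@eq_from_nth _ 0%N); rewrite size_mkseq // => n nu.
by rewrite nth_mkseq ?tu.
Qed.

End Cylinders.

Section CylinderMasses.
Variables (R : realType) (T : Type) (code : T -> nat -> nat).
Variables (wt : nat -> nat -> T -> R) (cns : nat -> T -> T) (x0 : T).
Hypothesis wt_ge0 : forall k i t, 0 <= wt k i t.
Hypothesis code_cns : forall k i t, wt k i t != 0 ->
  forall n, code (cns i t) n = if n is n'.+1 then code t n' else i.
Variable B : nat -> nat -> R.
Hypothesis wt_le : forall k i t, wt k i t <= B k i.
Hypothesis B_summable : forall k, (\sum_(i <oo) (B k i)%:E < +oo)%E.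
Variable b : nat -> R.
Hypothesis b_gt0 : forall k, 0 < b k.
Hypothesis wt_ge : forall k t, ((b k)%:E <= \sum_(i <oo) (wt k i t)%:E)%E.

Let B_ge0 k i : 0 <= B k i.
Proof. exact: le_trans (wt_ge0 k i x0) (wt_le k i x0). Qed.

Let incyl_cns k i j v t : wt k j t != 0 ->
  incyl code (i :: v) (cns j t) = (j == i) && incyl code v t.
Proof.
move=> wt0; rewrite /incyl/= /mkseq/= eqseq_cons (code_cns wt0).
congr (_ && _); rewrite -[1%N]/(1 + 0)%N iotaDl -map_comp.
by congr (_ == _); apply: eq_map => n /=; rewrite (code_cns wt0).
Qed.

Let wt_event k P j t (c : bool) : (wt k j t != 0 -> P (cns j t) = c) ->
  ((wt k j t)%:E * event R P (cns j t) = (wt k j t * c%:R)%:E)%E.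
Proof.
have [->|wt0 /(_ isT) Pc] := eqVneq (wt k j t) 0; first by rewrite mul0e mul0r.
by rewrite /event Pc EFinM.
Qed.

(** Only the branch [i] survives in the series. The hypothesis is restricted to nonzero weights
    because [cns j t] is meaningless elsewhere. *)
Lemma ruelle_event_cons k i P Q t :
  (forall j, wt k j t != 0 -> Q (cns j t) = (j == i) && P t) ->
  ruelle wt cns k (event R Q) t = ((wt k i t)%:E * event R P t)%E.
Proof.
move=> QP; rewrite /ruelle (@nneseriesD1 _ _ i xpredT)//; last first.
  by move=> j _; rewrite mule_ge0 ?lee_fin ?event_ge0.
rewrite eseries0 ?adde0.
  by rewrite (wt_event (QP i)) eqxx/= EFinM.
by move=> j _ /= /negbTE ji; rewrite (wt_event (QP j)) ji mulr0.
Qed.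

(** What the first [N] children of the cylinder of [u] leave uncovered. *)
Let tail_event (N : nat) u t := incyl code u t && (N <= code t (size u))%N.

Let tail k N := fine (\sum_(N <= i <oo) (B k i)%:E)%E.

Let tail_fin k N : (\sum_(N <= i <oo) (B k i)%:E)%E \is a fin_num.
Proof.
rewrite ge0_fin_numE; last by apply: nneseries_ge0 => i _ _; rewrite lee_fin.
apply: le_lt_trans (B_summable k).
rewrite (@nneseries_split _ _ 0 N); last by move=> i _; rewrite lee_fin.
by rewrite leeDr// sume_ge0// => i _; rewrite lee_fin.
Qed.

Let tail_ge0 k N : 0 <= tail k N.
Proof. by apply/fine_ge0/nneseries_ge0 => i _ _; rewrite lee_fin. Qed.

Let tail_cvg k : tail k N @[N --> \oo] --> (0 : R).
Proof.
apply: fine_cvg; apply: nneseries_tail_cvg => // i _.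
by rewrite lee_fin.
Qed.

Let ruelle_le k t : (ruelle wt cns k (event R xpredT) t <= (tail k 0)%:E)%E.
Proof.
rewrite /tail fineK//; apply: lee_nneseries => i.
  by rewrite mule_ge0// lee_fin.
by rewrite /event mule1 lee_fin.
Qed.

Let ruelle_ge k t : ((b k)%:E <= ruelle wt cns k (event R xpredT) t)%E.
Proof.
rewrite (_ : ruelle _ _ _ _ _ = \sum_(i <oo) (wt k i t)%:E)%E//.
by apply: eq_eseriesr => i _; rewrite mule1.
Qed.

Let ruelle_tail k N t :
  (ruelle wt cns k (event R (tail_event N [::])) t <=
    (tail k N)%:E * event R xpredT t)%E.
Proof.
have h i : ((wt k i t)%:E * event R (tail_event N [::]) (cns i t) =
  (wt k i t * (N <= i)%N%:R)%:E)%E.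
  apply: wt_event => wt0; rewrite /tail_event/= (code_cns wt0).
  by [].
rewrite /event mule1 /tail fineK// /ruelle.
rewrite (@nneseries_split _ _ 0 N); last first.
  by move=> i _; rewrite h lee_fin mulr_ge0.
rewrite add0n big_nat big1 ?add0e.
  apply: lee_nneseries => i _; rewrite h lee_fin ?mulr_ge0//.
  by apply: le_trans (wt_le k i t); rewrite ler_piMr//; case: (N <= i)%N.
by move=> i /andP[_ iN]; rewrite h leqNgt iN mulr0.
Qed.

(** The charges of [conformal_charges] are only finitely additive; the summable bound [B] forces the
    remainders [tail_event N u] to have vanishing mass, which gives the series over children. *)
Lemma cylinder_masses :
  exists (a : nat -> seq nat -> R) (lam : nat -> R),
    [/\ (forall k u, 0 <= a k u) /\ (forall k, a k [::] = 1),
        (forall k u, (forall t, ~~ incyl code u t) -> a k u = 0),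
        (forall k u,
           series (fun i => a k (rcons u i)) n @[n --> \oo] --> a k u),
        (forall k, 0 < lam k) &
        forall k i v (C : R), 0 <= C ->
          ((forall t, incyl code v t -> wt k i t <= C) ->
            lam k * a k (i :: v) <= C * a k.+1 v) /\
          ((forall t, incyl code v t -> C <= wt k i t) ->
            C * a k.+1 v <= lam k * a k (i :: v))].
Proof.
have [al [lam [al0 alT alD lamb step]]] :=
  conformal_charges wt_ge0 x0 b_gt0 ruelle_ge ruelle_le.
have lam0 k : 0 < lam k by exact: lt_le_trans (lamb k).
have al_eq k P Q : P =1 Q -> al k P = al k Q by move=> /funext ->.
exists (fun k u => al k (incyl code u)), lam; split => //.
- move=> k u u0; have al00 : al k xpred0 = 0.
    have h : al k xpred0 = al k xpred0 + al k xpred0.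
      by rewrite -alD.
    by apply: (addrI (al k xpred0)); rewrite addr0.
  by rewrite -al00; apply: al_eq => t; apply/negbTE.
- move=> k u.
  (* Finite additivity peels off [N] children exactly, so only the remainder has to be
     controlled. *)
  have split_cyl N : al k (incyl code u) =
      series (fun i => al k (incyl code (rcons u i))) N + al k (tail_event N u).
    rewrite /series/=; elim: N => [|N IH].
      rewrite big_geq// add0r; apply: al_eq => t.
      by rewrite /tail_event leq0n andbT.
    rewrite IH big_nat_recr//= -addrA; congr (_ + _).
    rewrite -alD => [|t].
      apply: al_eq => t; rewrite /tail_event incyl_rcons leq_eqVlt eq_sym.
      by rewrite andb_orr.
    rewrite /tail_event incyl_rcons; case: eqP => [->|_]; rewrite ?andbF//.
    by rewrite ltnn !andbF.
  have tail0 : al k (tail_event N u) @[N --> \oo] --> (0 : R).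
    (* For the empty word the remainder is at most a tail of the series of [B k], divided by
       [lam k]. For [i :: v] one operator passes to the remainder of [v] at level [k.+1], at the
       cost of the factor [B k i / lam k]; hence the induction over all levels. *)
    elim: u k {split_cyl} => [|i v IH] k.
      apply: (@squeeze_cvgr _ _ _ _ (fun=> 0)
        (fun N => (lam k)^-1 * tail k N)) => //.
      - near=> N; rewrite al0/= mulrC ler_pdivlMr// mulrC.
        have [+ _] :=
          step k (tail_event N [::]) xpredT (tail k N) (tail_ge0 k N).
        by rewrite alT mulr1; apply => t; exact: ruelle_tail.
      - exact: cvg_cst.
      - by rewrite -(mulr0 (lam k)^-1); apply: cvgM => //; exact: cvg_cst.
    apply: (@squeeze_cvgr _ _ _ _ (fun=> 0)
      (fun N => (lam k)^-1 * B k i * al k.+1 (tail_event N v))) => //.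
    - near=> N; rewrite al0/= -mulrA mulrC ler_pdivlMr// mulrC.
      have [+ _] :=
        step k (tail_event N (i :: v)) (tail_event N v) _ (B_ge0 k i).
      apply => t; rewrite (@ruelle_event_cons k i (tail_event N v)).
        by rewrite lee_wpmul2r ?lee_fin// event_ge0.
      move=> j wt0; rewrite /tail_event (incyl_cns _ _ wt0)/= (code_cns wt0).
      by rewrite andbA.
    - exact: cvg_cst.
    - rewrite -(mulr0 ((lam k)^-1 * B k i)); apply: cvgM; last exact: IH.
      exact: cvg_cst.
  rewrite (_ : (fun n => _) =
    (fun N => al k (incyl code u) - al k (tail_event N u))).
    by rewrite -[X in _ --> X]subr0; apply: cvgB => //; exact: cvg_cst.
  by apply/funext => N; rewrite (split_cyl N) addrK.
- move=> k i v C C0.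
  have rE t : ruelle wt cns k (event R (incyl code (i :: v))) t =
      ((wt k i t)%:E * event R (incyl code v) t)%E.
    by apply: ruelle_event_cons => j wt0; exact: incyl_cns wt0.
  have [le_step ge_step] := step k (incyl code (i :: v)) (incyl code v) C C0.
  split => Cv; [apply: le_step|apply: ge_step] => t; rewrite rE /event;
    rewrite -!EFinM lee_fin; case: (boolP (incyl code v t)) => [/Cv|_];
    by rewrite ?mulr0 ?mulr1.
Unshelve. all: by end_near. Qed.

End CylinderMasses.

(** * Measures with prescribed cylinder masses *)

Section NestedIntervals.
Variables (R : realType) (a : seq nat -> R).
Hypothesis a_ge0 : forall u, 0 <= a u.
Hypothesis a_series :
  forall u, series (fun i => a (rcons u i)) n @[n --> \oo] --> a u.
Implicit Types (u v : seq nat) (x : R).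

(** Left endpoint of the interval of [u]: at each depth, the masses of the earlier siblings are
    added. *)
Definition word_start u : R := \sum_(n < size u)
  series (fun i => a (rcons (take n u) i)) (nth 0%N u n).

Lemma word_start_rcons u i : word_start (rcons u i) =
  word_start u + series (fun j => a (rcons u j)) i.
Proof.
rewrite /word_start size_rcons big_ord_recr/= nth_rcons ltnn eqxx.
rewrite -cats1 take_size_cat//; congr (_ + _); apply: eq_bigr => -[n nu] _ /=.
by rewrite nth_cat nu takel_cat// ltnW.
Qed.

(** Half-open, so that the children tile their parent without overlap and a word of mass 0 gets the
    empty interval. *)
Definition word_itv u : set R :=
  `[word_start u, word_start u + a u[%classic.

Let series_nd u : nondecreasing_seq (series (fun i => a (rcons u i))).
Proof. by apply: nondecreasing_series => n _ _; exact: a_ge0. Qed.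

Lemma word_itv_digit u x : word_itv u x -> exists i, word_itv (rcons u i) x.
Proof.
rewrite /word_itv/= in_itv/= => /andP[ux xu].
have ex : exists n, x - word_start u < series (fun i => a (rcons u i)) n.
  have : \forall n \near \oo,
      x - word_start u < series (fun i => a (rcons u i)) n.
    have := cvgr_gt (a u) (@a_series u) (x - word_start u).
    by apply; rewrite ltrBlDl.
  by move=> [n _ /(_ n (leqnn n))] h; exists n.
(* The digit is one less than the first index whose partial sum passes [x - word_start u]; index 0
   is excluded because the empty sum is 0. *)
have [[|i]] := ex_minnP ex.
  by rewrite /series/= big_geq// subr_lt0 ltNge ux.
rewrite ltrBlDl => xi imin; exists i; rewrite /= in_itv/= word_start_rcons.
rewrite -addrA -[X in _ + (_ + X)]/((fun j => a (rcons u j)) i).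
rewrite -seriesSr xi andbT.
by rewrite addrC -lerBrDr leNgt; apply/negP => /imin; rewrite ltnn.
Qed.

Lemma word_itv_rcons u i : word_itv (rcons u i) `<=` word_itv u.
Proof.
move=> x; rewrite /word_itv/= !in_itv/= word_start_rcons => /andP[ux xu].
apply/andP; split.
  by apply: le_trans ux; rewrite lerDl; apply: sumr_ge0 => j _; exact: a_ge0.
apply: (lt_le_trans xu); rewrite -addrA lerD2l.
rewrite -[X in _ + X]/((fun j => a (rcons u j)) i) -seriesSr.
have := @nondecreasing_cvgn_le _ _ (@series_nd u) (cvgP _ (@a_series u)) i.+1.
by rewrite (cvg_lim _ (@a_series u)).
Qed.

Lemma word_itv_take u n : word_itv u `<=` word_itv (take n u).
Proof.
elim/last_ind: u => [|u i IH] x; first by case: n.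
have [nu|un] := leqP n (size u).
  by move/word_itv_rcons/IH; rewrite -cats1 takel_cat.
by rewrite take_oversize// size_rcons.
Qed.

(** Parents agree by induction; among siblings [k < l], the interval of [k] ends at the partial sum
    of [k.+1] terms, which is at most the start of that of [l]. *)
Lemma word_itv_inj u v x : size u = size v ->
  word_itv u x -> word_itv v x -> u = v.
Proof.
elim/last_ind: u v => [|u i IH] v; first by case: v.
case/lastP: v => [|v j]; rewrite !size_rcons// => -[uv] ux vx.
have ? := IH v uv (word_itv_rcons ux) (word_itv_rcons vx); subst v.
suff lt k l : (k < l)%N ->
    word_itv (rcons u k) x -> word_itv (rcons u l) x -> False.
  by have [/lt/(_ ux vx)|/lt/(_ vx ux)|->] := ltngtP i j.
rewrite /word_itv/= !in_itv/= !word_start_rcons => kl /andP[_ xk] /andP[lx _].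
have := @series_nd u _ _ kl; rewrite seriesSr => le_kl.
have := le_lt_trans lx xk; rewrite -addrA ltrD2l => lt_lk.
by have := le_lt_trans le_kl lt_lk; rewrite ltxx.
Qed.

Lemma word_itv_ex x n : word_itv [::] x ->
  exists2 u, size u = n & word_itv u x.
Proof.
move=> x0; elim: n => [|n [u un /word_itv_digit[i ui]]]; first by exists [::].
by exists (rcons u i); rewrite // size_rcons un.
Qed.

Lemma measurable_word_itv u : measurable (word_itv u).
Proof. exact: measurable_itv. Qed.

(** All the intervals lie in [[0, 1[], where the uniform density is 1, so the mass is the length. *)
Lemma uniform_word_itv : a [::] = 1 ->
  forall u, uniform_prob (@ltr01 R) (word_itv u) = (a u)%:E.
Proof.
move=> a_nil u; rewrite /uniform_prob (eq_integral (fun=> 1%:E)); last first.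
  move=> x /set_mem/(@word_itv_take u 0).
  rewrite take0 /word_itv/= in_itv/= /word_start big_ord0 a_nil add0r.
  by rewrite /uniform_pdf => /andP[-> /ltW ->]; rewrite subr0 invr1.
rewrite integral_cst//=; last exact: measurable_word_itv.
rewrite mul1e /word_itv lebesgue_measure_itv/= lte_fin ltrDl.
rewrite lt_neqAle a_ge0 andbT; case: eqP => [<-//|_].
by rewrite -EFinB addrAC subrr add0r.
Qed.

End NestedIntervals.

(** * Coding of points by naturals; cylinders as a base of the topology *)

Section ShiftCode.
Variables (R : realType) (E : countType) (A : rel E).
Local Notation X := (shift_space R A).

(* Letters are coded by naturals, which turns sums over letters into series. *)
Definition code (t : X) (n : nat) : nat := pickle (t n).

Lemma code_inj (s t : X) n : code s n = code t n -> s n = t n.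
Proof. exact: (pcan_inj pickleK). Qed.

Lemma incyl_mkseq (s t : X) n :
  incyl code (mkseq (code t) n) s <-> (forall i, (i < n)%N -> s i = t i).
Proof.
split => [/incylP st i ni|st].
  by apply/code_inj; rewrite st ?size_mkseq// nth_mkseq.
apply/incylP => i; rewrite size_mkseq => ni.
by rewrite nth_mkseq// /code st.
Qed.

Lemma nbhs_incyl (t : X) (B : set X) :
  nbhs t B <-> exists n, incyl code (mkseq (code t) n) `<=` B.
Proof.
split.
  move=> /nbhs_ballP[e /= e0 tB].
  have [n] : exists n : nat, expR (- n%:R) < e.
    have [n en] : exists n : nat, - ln e < n%:R.
      exists (Num.truncn `|- ln e|).+1.
      by apply: le_lt_trans (ler_norm _) _; exact: truncnS_gt.
    by exists n; rewrite -ltr_ln ?posrE ?expR_gt0// expRK ltrNl.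
  (* A distance below [expR (- n%:R)] requires agreement up to index [n] included, that is, on
     [n.+1] letters. *)
  move=> ne; exists n.+1 => s /incyl_mkseq st; apply: tB.
  rewrite ballEmdist/=; apply: lt_trans ne; apply/sdist_lt => i ni.
  by rewrite st.
move=> [n nB]; apply/nbhs_ballP; exists (expR (- n%:R)) => /=.
  exact: expR_gt0.
move=> s; rewrite ballEmdist/= => /sdist_lt ts; apply: nB.
by apply/incyl_mkseq => i ni; rewrite ts// ltnW.
Qed.

Lemma open_incyl u : open [set t : X | incyl code u t].
Proof.
rewrite openE => t /= ut; apply/nbhs_incyl; exists (size u) => s.
by rewrite (eqP ut).
Qed.

(** The limit point is read off the diagonal. Admissibility concerns two consecutive letters only,
    and both can be read in one single witness. *)
Lemma shift_point (w : nat -> seq nat) : (forall n, size (w n) = n) ->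
  (forall m n, (m <= n)%N -> take m (w n) = w m) ->
  (forall n, exists t : X, incyl code (w n) t) ->
  exists t : X, forall n, incyl code (w n) t.
Proof.
move=> ws wt /choice[t tw].
have tE m n i : (i < m)%N -> (i < n)%N -> t m i = t n i.
  move=> im i_n; apply: code_inj.
  have tiE l : (i < l)%N -> code (t l) i = nth 0%N (w i.+1) i.
    move=> il; rewrite -(wt i.+1 l il) nth_take//.
    by apply/(incylP _ _ _ (tw l)); rewrite ws.
  by rewrite !tiE.
have sP n : A (t n.+1 n) (t n.+2 n.+1).
  by rewrite (tE n.+1 n.+2)//; exact: letterP.
exists (ShiftSpace R sP) => n; apply/incylP => i; rewrite ws => i_n.
rewrite /code/= (tE _ n)//.
by apply/(incylP _ _ _ (tw n)); rewrite ws.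
Qed.

End ShiftCode.

Arguments code {R E A} t n.

(** * Construction of a Borel probability from cylinder masses *)

Section CylinderMeasure.
Variables (R : realType) (E : countType) (A : rel E).
Variables (hE : inhabited E) (hA : finitely_primitive A).
Local Notation X := (shift_space R A).
Local Notation B := (borel_shift R hE hA).

Lemma measurable_open (O : set X) : open O -> measurable (O : set B).
Proof. exact: sub_gen_smallest. Qed.

Lemma open_bigcup_incyl (O : set X) : open O ->
  O = \bigcup_(u in [set u | incyl code u `<=` O]) [set t | incyl code u t].
Proof.
rewrite openE => oO; apply/seteqP; split => [t /oO/nbhs_incyl[n nO]|t [u uO]].
  by exists (mkseq (code t) n) => //=; apply/incyl_mkseq.
exact: uO.
Qed.

(** Words are countable, so every open set is a countable union of cylinders. *)
Lemma measurable_to_shift d (T : measurableType d) (f : T -> B) :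
  (forall u, measurable (f @^-1` [set t : X | incyl code u t])) ->
  measurable_fun [set: T] f.
Proof.
move=> fu; apply: (measurability (@open X : set (set B))) => //.
move=> _ [ O oO <-]; rewrite setTI (open_bigcup_incyl oO) preimage_bigcup.
rewrite bigcup_mkcond; apply: countable_bigcupT_measurable => [|u].
  exact: countableP.
by case: ifP.
Qed.

Variable a : seq nat -> R.
Hypothesis a_ge0 : forall u, 0 <= a u.
Hypothesis a_nil : a [::] = 1.
Hypothesis a_series :
  forall u, series (fun i => a (rcons u i)) n @[n --> \oo] --> a u.
Hypothesis a_empty : forall u, (forall t : X, ~~ incyl code u t) -> a u = 0.

(* The image of Lebesgue measure on [0, 1[ under the map sending a real to the
   word coded by the nested intervals that contain it. *)
Lemma probability_of_cylinders : exists m : probability B R,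
  forall u, m [set t | incyl code u t] = (a u)%:E.
Proof.
have [x0] := shift_inhabited R hE hA.
have /choice[f fP] : forall x, exists t : X,
    (word_itv a [::] x -> forall u, word_itv a u x <-> incyl code u t) /\
    (~ word_itv a [::] x -> t = x0).
  move=> x; have [xI|xI] := pselect (word_itv a [::] x); last by exists x0.
  have /choice[w wP] : forall n, exists u, size u = n /\ word_itv a u x.
    by move=> n; have [u un ux] := word_itv_ex a_series n xI; exists u.
  have [|m n mn|n|t tw] := @shift_point R E A w.
  - by move=> n; exact: (wP n).1.
  - apply: (word_itv_inj a_ge0 a_series _ _ (wP m).2).
      by rewrite size_take_min !(wP _).1; apply/minn_idPl.
    exact/word_itv_take/(wP n).2.
  (* An empty cylinder has mass 0, hence an empty interval, which cannot contain [x]. *)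
  - apply: contrapT => nt; have : a (w n) = 0.
      by apply: a_empty => t; apply/negP => tn; apply: nt; exists t.
    by have := (wP n).2; rewrite /word_itv/= in_itv/= => /andP[h1 +] h2;
      rewrite h2 addr0 ltNge h1.
  exists t; split=> // _ u.
  split=> [ux|/eqP ut].
    suff -> : u = w (size u) by [].
    by apply: (word_itv_inj a_ge0 a_series _ ux (wP _).2); rewrite (wP _).1.
  suff -> : u = w (size u) by exact: (wP _).2.
  by rewrite -{1}ut -(eqP (tw (size u))) (wP _).1.
have mI := measurable_word_itv a.
(* The second piece comes from the default value [x0]: it is the whole complement of [[0, 1[] or
   empty, and null for the uniform law in both cases. *)
have preE u : f @^-1` [set t | incyl code u t] =
    word_itv a u `|` (~` word_itv a [::] `&` [set _ | incyl code u x0]).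
  apply/seteqP; split => x /=.
    have [xI|xI] := pselect (word_itv a [::] x).
      by move/((fP x).1 xI u); left.
    by rewrite ((fP x).2 xI) => ?; right.
  case=> [ux|[xI]]; last by rewrite ((fP x).2 xI).
  apply/((fP x).1 _ u) => //.
  by move/(@word_itv_take _ _ a_ge0 a_series u 0): ux; rewrite take0.
have mN (u : seq nat) : measurable (~` word_itv a [::] `&`
    [set _ : measurableTypeR R | incyl code u x0]).
  apply: measurableI; first by apply: measurableC; exact: mI.
  have [h|h] := boolP (incyl code u x0).
    by rewrite (_ : mkset _ = setT)//; apply/seteqP; split.
  by rewrite (_ : mkset _ = set0)//; apply/seteqP; split => // _ /=; apply/negP.
have mf : measurable_fun [set: measurableTypeR R] (f : _ -> B).
  apply: measurable_to_shift => u; rewrite preE.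
  by apply: measurableU; [exact: mI|exact: mN].
pose F : {mfun measurableTypeR R >-> B} := HB.pack (f : measurableTypeR R -> B)
  (isMeasurableFun.Build _ _ _ _ _ mf).
have PI u := uniform_word_itv a_ge0 a_series a_nil u.
have P0 : uniform_prob (@ltr01 R) (~` word_itv a [::]) = 0.
  transitivity (1 - (a [::])%:E)%E; last by rewrite a_nil subee.
  by rewrite -PI; apply: probability_setC; exact: mI.
exists (distribution (uniform_prob (@ltr01 R)) F) => u.
transitivity (uniform_prob (@ltr01 R) (f @^-1` [set t | incyl code u t])).
  by [].
rewrite preE -PI; apply: measureU0; [exact: mI|exact: mN|].
apply: (@subset_measure0 _ _ _ (uniform_prob (@ltr01 R)) _ _ (mN u) _ _ P0).
  by apply: measurableC; exact: mI.
exact: subIsetl.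
Qed.

End CylinderMeasure.

(** * From cylinders to continuous functions *)

Section Disintegration.
Variables (R : realType) (E : countType) (A : rel E).
Variables (hE : inhabited E) (hA : finitely_primitive A).
Local Notation X := (shift_space R A).
Local Notation B := (borel_shift R hE hA).
Implicit Types (u v : seq nat) (g : X -> R).

Local Notation cylinder u := ([set t : X | incyl code u t]).

Lemma measurable_cylinder u : measurable (cylinder u : set B).
Proof. by apply: measurable_open; exact: open_incyl. Qed.

Lemma continuous_shift_measurable g : continuous g ->
  measurable_fun [set: B] (g : B -> R).
Proof.
move=> /continuousP cg; apply: (measurability _ (RGenOpens.measurableE R)).
move=> _ [_ [a [b ->] <-]]; rewrite setTI; apply: measurable_open.
exact/cg/interval_open.
Qed.

Lemma locally_constant_continuous g n :
  (forall s t : X, mkseq (code s) n = mkseq (code t) n -> g s = g t) ->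
  continuous g.
Proof.
move=> gn t V /nbhs_singleton gV; apply/nbhs_incyl; exists n => s /eqP.
by rewrite size_mkseq => /gn /= ->.
Qed.

Lemma cylinder_bigcup u :
  cylinder u = \bigcup_i cylinder (rcons u i).
Proof.
apply/seteqP; split => [t /= ut|t [i _]] /=; last first.
  by rewrite incyl_rcons => /andP[].
by exists (code t (size u)) => //=; rewrite incyl_rcons ut/=.
Qed.

Lemma trivIset_cylinder u : trivIset setT (fun i => cylinder (rcons u i)).
Proof.
move=> i j _ _ [t [/=]]; rewrite !incyl_rcons => /andP[_ /eqP <-].
by case/andP => _ /eqP.
Qed.

Lemma ge0_integral_cylinder (m : probability B R) (h : B -> \bar R) u :
  measurable_fun [set: B] h -> (forall t, (0 <= h t)%E) ->
  (\int[m]_(t in cylinder u) h t =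
   \sum_(i <oo) \int[m]_(t in cylinder (rcons u i)) h t)%E.
Proof.
move=> mh h0; rewrite cylinder_bigcup ge0_integral_bigcup//.
- by move=> i; exact: measurable_cylinder.
- by apply: measurable_funTS.
- exact: trivIset_cylinder.
Qed.

Variables (wt : X -> R) (cns : X -> X) (i : nat).
Hypothesis wt_ge0 : forall t, 0 <= wt t.
Hypothesis wt_cts : continuous wt.
Hypothesis cns_cts : continuous cns.
Hypothesis code_cns : forall t, wt t != 0 ->
  forall n, code (cns t) n = if n is n'.+1 then code t n' else i.
Variable b : R.
Hypothesis wt_le : forall t, wt t <= b.
Variable delta : nat -> R.
Hypothesis delta_cvg : delta n @[n --> \oo] --> (0 : R).
Hypothesis wt_bound : forall n s t, (0 < n)%N ->
  mkseq (code s) n = mkseq (code t) n -> wt s <= expR (delta n) * wt t.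
Variables (lam : R) (m m' : probability B R).
Variables (a a' : seq nat -> R).
Hypothesis mE : forall u, m (cylinder u) = (a u)%:E.
Hypothesis m'E : forall u, m' (cylinder u) = (a' u)%:E.
Hypothesis lam_gt0 : 0 < lam.
Hypothesis step : forall v (C : R), 0 <= C ->
  ((forall t : X, incyl code v t -> wt t <= C) ->
    lam * a (i :: v) <= C * a' v) /\
  ((forall t : X, incyl code v t -> C <= wt t) ->
    C * a' v <= lam * a (i :: v)).

Let a_ge0 u : 0 <= a u. Proof. by rewrite -lee_fin -mE measure_ge0. Qed.
Let a'_ge0 u : 0 <= a' u. Proof. by rewrite -lee_fin -m'E measure_ge0. Qed.

Let b_ge0 : 0 <= b.
Proof.
by have [t] := shift_inhabited R hE hA; exact: le_trans (wt_ge0 t) (wt_le t).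
Qed.

(** On a cylinder of [n] letters the weight varies by a factor of at most [expR (delta n)], so
    [wt t] divided or multiplied by it is a legitimate constant [C] in [step]. *)
Let wt_mass n v t : (0 < n)%N -> size v = n -> incyl code v t ->
  wt t * a' v <= expR (delta n) * (lam * a (i :: v)) /\
  expR (- delta n) * (lam * a (i :: v)) <= wt t * a' v.
Proof.
move=> n0 vn vt.
have sv s : incyl code v s -> mkseq (code s) n = mkseq (code t) n.
  by rewrite -vn => /eqP ->; rewrite (eqP vt).
split.
  rewrite -ler_pdivrMl ?expR_gt0// -expRN mulrA.
  apply: (step _ _).2 => [|s /sv st]; first by rewrite mulr_ge0 ?expR_ge0.
  by rewrite expRN ler_pdivrMl ?expR_gt0// wt_bound.
rewrite expRN ler_pdivrMl ?expR_gt0// mulrA.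
apply: (step _ _).1 => [|s /sv st]; first by rewrite mulr_ge0 ?expR_ge0.
by rewrite wt_bound.
Qed.

Let wt_mE (h : B -> R) : continuous (h : X -> R) ->
  measurable_fun [set: B] (fun t : B => (wt t * h (cns t))%:E).
Proof.
move=> ch; apply/measurable_EFinP.
have cwh : continuous (wt \* ((h : X -> R) \o cns)).
  move=> t; apply: continuousM; first exact: wt_cts.
  by apply: continuous_comp; [exact: cns_cts|exact: ch].
exact: continuous_shift_measurable cwh.
Qed.

(** Induction on the number [j] of letters that [v] lacks to have length [n]: both integrals split
    over the children of [v]. At full length [g] is constant on the cylinder of [i :: v], which has
    [n.+1] letters, and [wt_mass] concludes. *)
Let integral_cylinder_bounds n j v (g : X -> R) : (0 < n)%N ->
  (size v + j = n)%N -> (forall t, 0 <= g t) ->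
  (forall s t, mkseq (code s) n.+1 = mkseq (code t) n.+1 -> g s = g t) ->
  (\int[m']_(t in cylinder v) (wt t * g (cns t))%:E <=
    (expR (delta n) * lam)%:E * \int[m]_(t in cylinder (i :: v)) (g t)%:E)%E /\
  ((expR (- delta n) * lam)%:E * \int[m]_(t in cylinder (i :: v)) (g t)%:E <=
   \int[m']_(t in cylinder v) (wt t * g (cns t))%:E)%E.
Proof.
move=> n0 + g0 gn; have cg := locally_constant_continuous gn.
have mg : measurable_fun [set: B] (EFin \o (g : B -> R)).
  by apply/measurable_EFinP; exact: continuous_shift_measurable.
elim: j v => [|j IH] v; last first.
  rewrite addnS -addSn => vn.
  have vjn l : (size (rcons v l) + j = n)%N by rewrite size_rcons.
  have wg0 t : (0 <= (wt t * g (cns t))%:E)%E by rewrite lee_fin mulr_ge0.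
  have g0E t : (0 <= (g t)%:E)%E by rewrite lee_fin.
  have Ig0 u : (0 <= \int[m]_(t in cylinder u) (g t)%:E)%E.
    exact: integral_ge0.
  rewrite (ge0_integral_cylinder m' v (wt_mE cg) wg0).
  rewrite (ge0_integral_cylinder m (i :: v) mg g0E).
  rewrite -!nneseriesZl//.
  split; apply: lee_nneseries => l _.
  - by move=> _; exact: integral_ge0.
  - by rewrite rcons_cons; exact: (IH _ (vjn l)).1.
  - by move=> _; rewrite mule_ge0// lee_fin mulr_ge0 ?expR_ge0 ?(ltW lam_gt0).
  - by rewrite rcons_cons; exact: (IH _ (vjn l)).2.
rewrite addn0 => vn.
(* The common value of [g] on the cylinder, with default 0 if the cylinder is empty. *)
pose c := if pselect (exists t : X, incyl code (i :: v) t) is left h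
  then g (projT1 (cid h)) else 0.
have c0 : 0 <= c by rewrite /c; case: pselect.
have gc t : incyl code (i :: v) t -> g t = c.
  move=> ivt; rewrite /c; case: pselect => [h|]; last by case; exists t.
  case: cid => s /= ivs; apply: gn; rewrite -vn.
  by rewrite (eqP ivt : mkseq _ (size v).+1 = _)
    (eqP ivs : mkseq _ (size v).+1 = _).
have wgc t : incyl code v t -> wt t * g (cns t) = wt t * c.
  move=> vt; have [->|wt0] := eqVneq (wt t) 0; first by rewrite !mul0r.
  rewrite gc//; apply/incylP => -[|l] /=; rewrite (code_cns wt0)//.
  by rewrite ltnS => lv; exact: (incylP _ _ _ vt).
have -> : (\int[m]_(t in cylinder (i :: v)) (g t)%:E = (c * a (i :: v))%:E)%E.
  rewrite (eq_integral (cst c%:E)); last by move=> t /set_mem /gc ->.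
  by rewrite integral_cst; [rewrite EFinM -mE|exact: measurable_cylinder].
rewrite (eq_integral (fun t : B => (wt t * c)%:E)); last first.
  by move=> t /set_mem /wgc ->.
have cst_le C : (forall t, incyl code v t -> wt t <= C) ->
  (\int[m']_(t in cylinder v) (wt t * c)%:E <= (C * c * a' v)%:E)%E.
  move=> wC; apply: (@le_trans _ _ (\int[m']_(t in cylinder v) (C * c)%:E)%E).
    apply: ge0_le_integral => //.
    - exact: measurable_cylinder.
    - by move=> t _; rewrite lee_fin mulr_ge0.
    - apply: measurable_funTS; exact: (@wt_mE (cst c) (@cst_continuous _ _ _)).
    - by move=> t /wC; rewrite lee_fin; apply: ler_wpM2r.
  rewrite integral_cst; last exact: measurable_cylinder.
  by rewrite [in leRHS]EFinM -m'E.
have cst_ge C : 0 <= C -> (forall t, incyl code v t -> C <= wt t) ->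
  ((C * c * a' v)%:E <= \int[m']_(t in cylinder v) (wt t * c)%:E)%E.
  move=> C0 wC.
  apply: (@le_trans _ _ (\int[m']_(t in cylinder v) (C * c)%:E)%E).
    rewrite integral_cst; last exact: measurable_cylinder.
    by rewrite [in leLHS]EFinM -m'E.
  apply: ge0_le_integral => //.
  - exact: measurable_cylinder.
  - by move=> t _; rewrite lee_fin mulr_ge0.
  - apply: measurable_funTS; exact: (@wt_mE (cst c) (@cst_continuous _ _ _)).
  - by move=> t /wC; rewrite lee_fin; apply: ler_wpM2r.
(* The division by [a' v] below is then impossible, but [step] with the global bound [b] shows that
   [lam * a (i :: v)] vanishes too. *)
have [av0|av0] := eqVneq (a' v) 0.
  have av : lam * a (i :: v) = 0.
    apply/eqP; rewrite eq_le mulr_ge0 ?(ltW lam_gt0)// andbT.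
    by rewrite -(mulr0 b) -av0; apply: (step _ b_ge0).1.
  have e0 (e : R) : e * lam * (c * a (i :: v)) = 0 by rewrite mulrACA av mulr0.
  rewrite -!EFinM !e0; split.
    by apply: le_trans (cst_le b _) _ => //; rewrite av0 mulr0.
  by apply: le_trans (cst_ge 0 _ _) => //; rewrite !mul0r.
have av_gt0 : 0 < a' v by rewrite lt_neqAle eq_sym av0/=.
rewrite -!EFinM.
(* The quotient [lam * a (i :: v) / a' v] acts as a mean weight on the cylinder of [v], which
   [wt_mass] compares with [wt]. *)
have cE (e : R) : e * lam * (c * a (i :: v)) =
    e * (lam * a (i :: v)) / a' v * c * a' v.
  by rewrite mulrACA [RHS]mulrAC divfK// mulrAC.
split; rewrite cE.
  apply: cst_le => t vt; rewrite ler_pdivlMr//.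
  exact: (wt_mass n0 vn vt).1.
apply: cst_ge => [|t vt].
  by rewrite !mulr_ge0 ?expR_ge0 ?invr_ge0 ?(ltW lam_gt0).
rewrite ler_pdivrMr//; exact: (wt_mass n0 vn vt).2.
Qed.

(** Approximation of [g] by functions of finitely many letters: dominated convergence applies on
    both sides, with constants [b * M] and [M], and the distortion factors [expR (delta n)] and
    [expR (- delta n)] tend to 1. *)
Lemma integral_branch (g : X -> R) M :
  continuous g -> (forall t, 0 <= g t <= M) ->
  (\int[m']_t (wt t * g (cns t))%:E =
   lam%:E * \int[m]_(t in cylinder [:: i]) (g t)%:E)%E.
Proof.
move=> cg gM.
(* A representative that depends on the word only, so that [gn n] depends on [n] letters only. *)
have /choice[rho rhoP] : forall u, exists s : X,
    forall t : X, incyl code u t -> incyl code u s.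
  move=> u; have [t0] := shift_inhabited R hE hA.
  have [[t ut]|nu] := pselect (exists t : X, incyl code u t).
    by exists t.
  by exists t0 => t ut; case: nu; exists t.
pose gn n (t : X) := g (rho (mkseq (code t) n)).
have gnP n (s t : X) : mkseq (code s) n = mkseq (code t) n -> gn n s = gn n t.
  by rewrite /gn => ->.
have gn0 n t : 0 <= gn n t by have /andP[] := gM (rho (mkseq (code t) n)).
have gnM n t : gn n t <= M by have /andP[] := gM (rho (mkseq (code t) n)).
have cgn n := locally_constant_continuous (gnP n).
have gn_cvg t : gn n.+1 t @[n --> \oo] --> g t.
  move=> V /cg; rewrite nbhs_filterE => /nbhs_incyl[N NV].
  exists N => // n /= Nn; apply: NV; apply/incyl_mkseq => l lN.
  have /incyl_mkseq := rhoP (mkseq (code t) n.+1) t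
    ((incyl_mkseq _ _ _).2 (fun _ _ => erefl)).
  by apply; rewrite ltnS (leq_trans (ltnW lN)).
have M0 : 0 <= M.
  have [t] := shift_inhabited R hE hA.
  by have /andP[] := gM t; exact: le_trans.
have cvg' : (\int[m']_t (wt t * gn n.+1 (cns t))%:E @[n --> \oo] -->
    \int[m']_t (wt t * g (cns t))%:E)%E.
  have [] := @dominated_convergence _ B R m' setT measurableT
    (fun n (t : B) => (wt t * gn n.+1 (cns t))%:E)
    (fun t : B => (wt t * g (cns t))%:E)
    (cst (b * M)%:E).
  - by move=> n; apply: wt_mE; exact: cgn.
  - exact: wt_mE.
  - apply: aeW => t _; apply: cvg_EFin; first exact: nearW.
    by apply: cvgM; [exact: cvg_cst|exact: gn_cvg].
  - by apply: finite_measure_integrable_cst.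
  - apply: aeW => t n _; rewrite abse_EFin lee_fin ger0_norm ?mulr_ge0//.
    by rewrite ler_pM.
  - by [].
have mcyl : measurable (cylinder [:: i] : set B) by exact: measurable_cylinder.
have mcg (h : X -> R) : continuous h ->
    measurable_fun (cylinder [:: i] : set B) (fun t : B => (h t)%:E).
  move=> ch; apply/measurable_EFinP; apply: measurable_funTS.
  exact: continuous_shift_measurable.
have [Ig cvg] :
    m.-integrable (cylinder [:: i] : set B) (fun t : B => (g t)%:E) /\
    (\int[m]_(t in cylinder [:: i]) (gn n.+1 t)%:E @[n --> \oo] -->
    \int[m]_(t in cylinder [:: i]) (g t)%:E)%E.
  have [] := @dominated_convergence _ B R m (cylinder [:: i]) mcyl
    (fun n (t : B) => (gn n.+1 t)%:E) (fun t : B => (g t)%:E) (cst M%:E).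
  - by move=> n; apply: mcg; exact: cgn.
  - exact: mcg.
  - apply: aeW => t _; apply: cvg_EFin; first exact: nearW.
    exact: gn_cvg.
  - exact: finite_measure_integrable_cst.
  - by apply: aeW => t n _; rewrite abse_EFin lee_fin ger0_norm.
  - by [].
have I_fin : (\int[m]_(t in cylinder [:: i]) (g t)%:E)%E \is a fin_num.
  exact: integrable_fin_num.
have eE (e : nat -> R) : e n @[n --> \oo] --> (0 : R) ->
    ((expR (e n) * lam)%:E * \int[m]_(t in cylinder [:: i]) (gn n.+1 t)%:E)%E
    @[n --> \oo] --> (lam%:E * \int[m]_(t in cylinder [:: i]) (g t)%:E)%E.
  move=> e0; apply: cvgeM => //.
    by rewrite mule_def_fin.
  apply: cvg_EFin; first exact: nearW.
  rewrite -[X in _ --> X]mul1r -expR0; apply: cvgM; last exact: cvg_cst.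
  apply: continuous_cvg => //; exact: continuous_expR.
(* The empty word lacks all [n] letters, so [j] is [n]; the test function has depth [n.+1], one more
   letter because of the prefix [i]. *)
have bounds n : (0 < n)%N -> _ := fun n0 =>
  integral_cylinder_bounds (v := [::]) n0 (add0n n) (gn0 n.+1) (gnP n.+1).
have cylT : cylinder [::] = setT by apply/seteqP.
apply/eqP; rewrite eq_le; apply/andP; split.
  apply: (lee_cvg_to cvg' (eE _ delta_cvg)); near=> n.
  have n0 : (0 < n)%N by near: n; exact: nbhs_infty_gt.
  by have := (bounds n n0).1; rewrite cylT.
have delta_cvgN : (- delta n) @[n --> \oo] --> (0 : R).
  by rewrite -oppr0; exact: cvgN.
apply: (lee_cvg_to (eE _ delta_cvgN) cvg'); near=> n.
have n0 : (0 < n)%N by near: n; exact: nbhs_infty_gt.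
by have := (bounds n n0).2; rewrite cylT.
Unshelve. all: by end_near. Qed.

End Disintegration.

(** * Hoelder potentials on a finitely primitive shift *)

Section Prepend.
Variables (R : realType) (E : countType) (A : rel E).
Local Notation X := (shift_space R A).
Implicit Types (i n : nat) (s t : X) (phi : X -> R).

Definition branch i t : option {e : E | A e (t 0%N)} :=
  obind insub (@pickle_inv E i).

(* [t] itself when [i] is not the code of a letter that may precede [t]. *)
Definition prepend i t : X := if branch i t is Some e then scons e else t.

Definition weight phi i t : R :=
  if branch i t then expR (phi (prepend i t)) else 0.

Lemma branchE i t : branch i t =
  (if @pickle_inv E i is Some e then A e (t 0%N) else false) :> bool.
Proof.
rewrite /branch; case: pickle_inv => //= e.
by case: insubP => [u ->|/negbTE ->].
Qed.

Lemma code_prepend i t n : branch i t ->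
  code (prepend i t) n = if n is n'.+1 then code t n' else i.
Proof.
rewrite /prepend; case bi : (branch i t) => [e|//] _; case: n => [|n] //=.
rewrite /code/=; move: bi; rewrite /branch.
case pi : pickle_inv => [e'|//] /=; case: insubP => [u _ ue|//] [<-].
by rewrite ue; have := @pickle_invK E i; rewrite pi.
Qed.

Lemma weight_ge0 phi i t : 0 <= weight phi i t.
Proof. by rewrite /weight; case: ifP => // _; exact: expR_ge0. Qed.

Lemma weight_neq0 phi i t : weight phi i t != 0 -> branch i t.
Proof. by rewrite /weight; case: ifP => //; rewrite eqxx. Qed.

Lemma mkseq_code n s t : mkseq (code s) n = mkseq (code t) n <->
  forall l, (l < n)%N -> s l = t l.
Proof.
split => [st l ln|st]; last first.
  by apply/eq_in_map => l; rewrite mem_iota => /andP[_ ln]; rewrite /code st.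
by apply: code_inj; rewrite -(nth_mkseq 0%N (code s) ln) st nth_mkseq.
Qed.

Lemma branch_eq i s t : s 0%N = t 0%N -> branch i s = branch i t :> bool.
Proof. by rewrite !branchE => ->. Qed.

(** Prepending gains one letter of agreement; at least one common letter ensures that [i] may
    precede both points or neither. *)
Lemma prepend_agree i s t n : (0 < n)%N ->
  mkseq (code s) n = mkseq (code t) n -> branch i s ->
  forall l, (l <= n)%N -> prepend i s l = prepend i t l.
Proof.
move=> n0 st bs l ln; have st' := (mkseq_code _ _ _).1 st.
have bt : branch i t by rewrite -(branch_eq i (st' _ n0)).
apply: code_inj; rewrite !code_prepend//.
by case: l ln => // l ln; rewrite /code st'.
Qed.

Lemma prepend_continuous i : continuous (prepend i).
Proof.
move=> t V /nbhs_incyl[n nV]; apply/nbhs_incyl; exists n.+1 => s.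
move=> /incyl_mkseq st /=; apply: nV; apply/incyl_mkseq => l ln.
have [bs|bs] := boolP (branch i s : bool).
  apply: (prepend_agree (n := n.+1)) => //; last exact/ltnW/ltnW.
  exact/mkseq_code.
have bt : ~~ branch i t by rewrite -(branch_eq i (st _ (ltn0Sn n))).
rewrite /prepend; case: (branch i s) bs => // _; case: (branch i t) bt => // _.
by rewrite st// ltnW.
Qed.

(** Whether [i] may precede [t] depends on the first letter of [t], so both cases of the definition
    are locally constant. *)
Lemma weight_continuous phi i : continuous phi -> continuous (weight phi i).
Proof.
move=> cphi t.
have cE : continuous (expR \o (phi \o prepend i)).
  move=> s; apply: continuous_comp; last exact: continuous_expR.
  by apply: continuous_comp; [exact: prepend_continuous|exact: cphi].
have [bt|bt] := boolP (branch i t : bool); last first.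
  move=> V; rewrite /weight ifN// => /nbhs_singleton V0.
  apply/nbhs_incyl; exists 1%N => s /incyl_mkseq /(_ 0%N erefl) st /=.
  by rewrite ifN// (branch_eq i st).
move=> V; rewrite /weight bt => /cE/nbhs_incyl[n nV].
apply/nbhs_incyl; exists n.+1 => s /incyl_mkseq st /=.
rewrite (branch_eq i (st _ (ltn0Sn n))) bt.
by apply: nV; apply/incyl_mkseq => l ln; apply: st; exact: ltnW.
Qed.

Variables (phi : X -> R) (V gamma : R).
Hypothesis gamma_gt0 : 0 < gamma.
Hypothesis V_ge0 : 0 <= V.
Hypothesis phi_holder : forall s t, s <> t -> s 0%N = t 0%N ->
  `|phi s - phi t| <= V * sdist s t `^ gamma.

Definition holder_modulus n : R := V * expR (- n%:R) `^ gamma.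

Lemma holder_modulus_ge0 n : 0 <= holder_modulus n.
Proof. by rewrite mulr_ge0// powR_ge0. Qed.

Lemma holder_modulus_cvg : holder_modulus n @[n --> \oo] --> 0.
Proof.
rewrite -(mulr0 V); apply: cvgM; first exact: cvg_cst.
(* A geometric sequence, of ratio below 1 since [gamma] is positive. *)
rewrite (_ : (fun n => _) = (fun n => (expR (- gamma)) ^+ n)).
  by apply: cvg_expr; rewrite ger0_norm ?expR_ge0// -expR0 ltr_expR oppr_lt0.
apply/funext => n; rewrite -[LHS]/(_ `^ _) /powR gt_eqF ?expR_gt0// expRK.
by rewrite mulrN mulrC -mulrN expRM_natl.
Qed.

Lemma phi_diff s t n : (forall l, (l <= n)%N -> s l = t l) ->
  phi s <= holder_modulus n + phi t.
Proof.
move=> st; have [->|/eqP st_neq] := eqVneq s t.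
  by rewrite lerDr holder_modulus_ge0.
rewrite -lerBlDr; apply: le_trans (ler_norm _) _.
apply: le_trans (phi_holder st_neq (st 0%N (leq0n n))) _.
rewrite ler_wpM2l// ge0_ler_powR ?nnegrE ?sdist_ge0 ?expR_ge0//.
  exact: ltW.
by apply/ltW/sdist_lt.
Qed.

Lemma weight_bound i n s t : (0 < n)%N -> mkseq (code s) n = mkseq (code t) n ->
  weight phi i s <= expR (holder_modulus n) * weight phi i t.
Proof.
move=> n0 st; rewrite /weight.
rewrite -(branch_eq i ((mkseq_code _ _ _).1 st _ n0)).
case: ifP => [bs|_]; last by rewrite mulr0.
by rewrite -expRD ler_expR; apply: phi_diff; exact: prepend_agree.
Qed.

(** [s] and [t] may start differently: after prepending, both points start with the letter coded by
    [i], and the modulus at 0 is [V]. If that letter may not precede [s], the left side is 0. *)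
Lemma weight_le i s t : branch i t ->
  weight phi i s <= expR V * weight phi i t.
Proof.
move=> bt; rewrite /weight bt; case: ifP => [bs|_]; last first.
  by rewrite mulr_ge0 ?expR_ge0.
rewrite -expRD ler_expR; have := @phi_diff (prepend i s) (prepend i t) 0.
rewrite /holder_modulus oppr0 expR0 powR1 mulr1; apply => -[|//] _.
by apply: code_inj; rewrite !code_prepend.
Qed.

Lemma weight_ge e (z t : X) : z 0%N = e -> A e (t 0%N) ->
  expR (phi z - V) <= weight phi (pickle e) t.
Proof.
move=> ze et; have bt : branch (pickle e) t by rewrite branchE pickleK_inv.
rewrite /weight bt ler_expR lerBlDl.
have := @phi_diff z (prepend (pickle e) t) 0.
rewrite /holder_modulus oppr0 expR0 powR1 mulr1; apply => -[|//] _.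
by apply: code_inj; rewrite code_prepend// /code ze.
Qed.

(** [pickle] is injective on the admissible letters, and every natural outside its range on them has
    weight 0. *)
Lemma esum_branch (p : X -> R) t : (forall s, 0 <= p s) ->
  (\esum_(e in [set: {e : E | A e (t 0%N)}])
     (expR (phi (scons e)) * p (scons e))%:E =
   \sum_(i <oo) (weight phi i t)%:E * (p (prepend i t))%:E)%E.
Proof.
move=> p0; pose c (e : {e : E | A e (t 0%N)}) : nat := pickle (val e).
have bc e : branch (c e) t = Some e by rewrite /branch /c pickleK_inv/= valK.
rewrite nneseries_esumT; last first.
  by move=> i; rewrite mule_ge0 ?lee_fin ?weight_ge0.
rewrite (esumID (range c)); last first.
  by move=> i _; rewrite mule_ge0 ?lee_fin ?weight_ge0.
rewrite [X in _ = (_ + X)%E]esum1 ?adde0; last first.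
  move=> i [_ /= ic]; rewrite /weight.
  case bi : (branch i t) => [e|]; last first.
    by rewrite mul0e.
  exfalso; apply: ic; exists e => //; move: bi; rewrite /branch /c.
  case pi : pickle_inv => [e'|//] /=; case: insubP => [u _ ue|//] [<-].
  by rewrite ue; have := @pickle_invK E i; rewrite pi.
rewrite setTI (reindex_esum setT (range c) c); last first.
  split; [by move=> e _; exists e| |by []].
  by move=> e e' _ _ /(pcan_inj pickleK)/val_inj.
by apply: eq_esum => e _; rewrite /weight /prepend bc EFinM.
Qed.

End Prepend.

Section FinitePrimitivity.
Variables (R : realType) (E : countType) (A : rel E).
Local Notation X := (shift_space R A).

Lemma point_of_letter (hA : finitely_primitive A) e : exists t : X, t 0%N = e.
Proof.
case: hA => N _ [L _ prim].
have /choice[next nextP] : forall e, exists e', A e e'.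
  move=> e'; have [[[|a w] ?] /= _] := prim e' e'.
    by case/andP => ? _; exists e'.
  by case/andP => ? _; exists a.
have sP n : A (iter n next e) (iter n.+1 next e) by exact: nextP.
by exists (ShiftSpace R sP).
Qed.

(** A connecting word from [e] to [e] starts with a successor and ends with a predecessor of [e],
    and only finitely many letters occur in the connecting words. *)
Lemma finite_successors_predecessors (hA : finitely_primitive A) :
  exists rs : seq X, (forall e, exists2 r, r \in rs & A e (r 0%N)) /\
                     (forall e, exists2 r, r \in rs & A (r 0%N) e).
Proof.
have /choice[pt ptP] := point_of_letter hA.
case: hA => N N0 [L [/finite_seqP[ws ->] _] prim].
have hd e : exists a w, [/\ a :: w \in map val ws, A e a & A (last a w) e].
  have [w /= wws] := prim e e; case: w wws => [[|a w]] wN wws /=.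
    by have Nz : N = 0%N := esym (eqP wN); rewrite Nz in N0.
  rewrite rcons_path => /and3P[ea _ le]; exists a, w; split => //.
  by apply/mapP; exists (Tuple wN).
exists (flatten [seq map pt w | w <- map val ws]).
split => e; have [a [w [aws ea le]]] := hd e.
  exists (pt a); last by rewrite ptP.
  by apply/flatten_mapP; exists (a :: w) => //; exact: mem_head.
exists (pt (last a w)); last by rewrite ptP.
by apply/flatten_mapP; exists (a :: w) => //; rewrite map_f// mem_last.
Qed.

End FinitePrimitivity.

(** * Conformal measures for a sequence of Hoelder potentials *)

Section ConformalSequence.
Variables (R : realType) (E : countType) (A : rel E).
Variables (hE : inhabited E) (hA : finitely_primitive A).
Local Notation X := (shift_space R A).
Local Notation B := (borel_shift R hE hA).
Variables (phi : nat -> X -> R) (V : nat -> R) (gamma : R).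
Hypothesis gamma_gt0 : 0 < gamma.
Hypothesis V_ge0 : forall k, 0 <= V k.
Hypothesis phi_holder : forall k (s t : X), s <> t -> s 0%N = t 0%N ->
  `|phi k s - phi k t| <= V k * sdist s t `^ gamma.
Hypothesis phi_continuous : forall k, continuous (phi k).

Local Notation L := (ruelle (fun k => weight (phi k)) (@prepend R E A)).

Lemma measurable_branch k i (p : X -> R) : continuous p ->
  measurable_fun [set: B]
    (fun t : B => ((weight (phi k) i t)%:E * (p (prepend i t))%:E)%E).
Proof.
move=> cp.
have cwp : continuous (weight (phi k) i \* (p \o prepend i)).
  move=> t; apply: continuousM.
    by apply: weight_continuous; exact: phi_continuous.
  by apply: continuous_comp; [exact: prepend_continuous|exact: cp].
have := continuous_shift_measurable cwp : measurable_fun [set: B] _.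
move=> /measurable_EFinP; apply: eq_measurable_fun => t _.
by rewrite /= EFinM.
Qed.

Lemma measurable_ruelle k (p : X -> R) : continuous p -> (forall t, 0 <= p t) ->
  measurable_fun [set: B] (L k (EFin \o p)).
Proof.
move=> cp p0; apply: (ge0_emeasurable_sum (P := xpredT)) => [i t _ _|i _].
  by rewrite mule_ge0 ?lee_fin ?weight_ge0.
exact: measurable_branch.
Qed.

Hypothesis sum_finite : forall k t,
  (\sum_(i <oo) (weight (phi k) i t)%:E < +oo)%E.

Lemma conformal_measures :
  exists (m : nat -> probability B R) (lam : nat -> R),
    forall k (p : X -> R) (M : R), continuous p -> (forall t, 0 <= p t <= M) ->
      (\int[m k.+1]_t L k (EFin \o p) t =
       (lam k)%:E * \int[m k]_t (p t)%:E)%E.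
Proof.
have [x0] := shift_inhabited R hE hA.
have [rs [succ pred]] := finite_successors_predecessors R hA.
(* Every letter may precede one of the finitely many points [r], where [weight_le] compares its
   weight with that at any [t]. Summability follows from that of the weights at each [r]. *)
pose Bd k i : R := expR (V k) * \sum_(r <- rs) weight (phi k) i r.
have wt_le k i t : weight (phi k) i t <= Bd k i.
  have [bt|/negbTE bt] := boolP (branch i t : bool); last first.
    rewrite {1}/weight bt mulr_ge0 ?expR_ge0 ?sumr_ge0// => r _.
    exact: weight_ge0.
  have [r rrs br] : exists2 r, r \in rs & branch i r.
    move: bt; rewrite branchE; case pi : pickle_inv => [e|//] _.
    by have [r rrs er] := succ e; exists r; rewrite // branchE pi.
  apply: le_trans (weight_le gamma_gt0 (V_ge0 k) (@phi_holder k) t br) _.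
  rewrite ler_wpM2l ?expR_ge0// (big_rem r)//= lerDl sumr_ge0// => s _.
  exact: weight_ge0.
have Bd_summable k : (\sum_(i <oo) (Bd k i)%:E < +oo)%E.
  rewrite (eq_eseriesr (g := fun i => ((expR (V k))%:E *
      \sum_(r <- rs) (weight (phi k) i r)%:E)%E)); last first.
    by move=> i _; rewrite EFinM sumEFin.
  rewrite nneseriesZl; last first.
    by move=> i _; apply: sume_ge0 => r _; rewrite lee_fin weight_ge0.
  rewrite lte_mul_pinfty ?lee_fin ?expR_ge0//.
  rewrite nneseries_sum; last by move=> r i _; rewrite lee_fin weight_ge0.
  by apply: lte_sum_pinfty => r _.
(* A single term of the series suffices: the first letter of some [r] may precede [t], and its
   weight is at least [expR (phi k r - V k)]. *)
pose b k : R := expR (- (\sum_(r <- rs) `|phi k r|) - V k).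
have wt_ge k t : ((b k)%:E <= \sum_(i <oo) (weight (phi k) i t)%:E)%E.
  have [r rrs rt] := pred (t 0%N).
  rewrite (@nneseriesD1 _ _ (pickle (r 0%N)) xpredT)//; last first.
    by move=> i _; rewrite lee_fin weight_ge0.
  apply: (@le_trans _ _ (weight (phi k) (pickle (r 0%N)) t)%:E); last first.
    by rewrite leeDl// nneseries_ge0// => i _ _; rewrite lee_fin weight_ge0.
  rewrite lee_fin; apply: le_trans
    (weight_ge gamma_gt0 (V_ge0 k) (@phi_holder k) erefl rt).
  rewrite ler_expR lerD2r lerNl (big_rem r)//=.
  rewrite (le_trans (ler_norm (- phi k r)))// normrN lerDl sumr_ge0//.
have b_gt0 k : 0 < b k by exact: expR_gt0.
have code_cns k i t : weight (phi k) i t != 0 ->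
    forall n, code (prepend i t) n = if n is n'.+1 then code t n' else i.
  by move=> /weight_neq0 bt n; exact: code_prepend.
have [a [lam [[a0 a1] aE aS lam0 step]]] := cylinder_masses x0
  (fun k => weight_ge0 (phi k)) code_cns wt_le Bd_summable b_gt0 wt_ge.
have /choice[m mE] k :=
  probability_of_cylinders hE hA (a0 k) (a1 k) (aS k) (aE k).
exists m, lam => k p M cp pM.
have p0 t : 0 <= p t by have /andP[] := pM t.
have pE0 (t : X) : (0 <= (p t)%:E)%E by rewrite lee_fin.
have mp : measurable_fun [set: B] (fun t : B => (p t)%:E).
  by apply/measurable_EFinP; exact: continuous_shift_measurable.
have cylT : [set t : X | incyl code [::] t] = setT by apply/seteqP.
(* Both sides become series over the first letter, matched term by term by [integral_branch]. *)
have -> : (\int[m k]_t (p t)%:E = \sum_(i <oo)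
    \int[m k]_(t in [set t : X | incyl code [:: i] t]) (p t)%:E)%E.
  by rewrite -cylT (ge0_integral_cylinder (m k) [::] mp pE0).
rewrite integral_nneseries//; first last.
- by move=> i t _; rewrite mule_ge0 ?lee_fin ?weight_ge0.
- by move=> i; exact: measurable_branch.
rewrite -nneseriesZl; last first.
  by move=> i _; exact: integral_ge0.
apply: eq_eseriesr => i _.
rewrite -(@integral_branch R E A hE hA (weight (phi k) i) (prepend i) i
  (weight_ge0 (phi k) i)
  (@weight_continuous R E A (phi k) i (@phi_continuous k))
  (@prepend_continuous R E A i) (@code_cns k i) (Bd k i) (wt_le k i)
  (holder_modulus (V k) gamma) (holder_modulus_cvg _ gamma_gt0)
  (@weight_bound _ _ _ _ _ _ gamma_gt0 (V_ge0 k) (@phi_holder k) i)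
  (lam k) (m k) (m k.+1) (a k) (a k.+1) (mE k) (mE k.+1) (lam0 k)
  (step k i) p M cp pM).
by apply: eq_integral => t _; rewrite EFinM.
Qed.

(** Exponentials are nonnegative, so they commute with positive and negative parts. The level [k]
    takes the place of the random parameter. *)
Lemma transferE k (g : X -> R) t :
  transfer (fun t k => phi k t) k g t =
  (L k (fun s => (Num.max (g s) 0)%:E) t -
   L k (fun s => (Num.max (- g s) 0)%:E) t)%E.
Proof.
have max0 (x : R) : 0 <= Num.max x 0 by rewrite le_max lexx orbT.
rewrite /transfer; congr (_ - _)%E.
  apply: etrans (esum_branch (phi k) t (fun s => max0 (g s))).
  apply: eq_esum => e _.
  by rewrite funeposE -EFin_max maxr_pMr ?expR_ge0// mulr0.
apply: etrans (esum_branch (phi k) t (fun s => max0 (- g s))).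
apply: eq_esum => e _.
by rewrite funenegE -EFinN -EFin_max maxr_pMr ?expR_ge0// mulr0 mulrN.
Qed.

Lemma conformal_sequence :
  exists (m : nat -> probability B R) (lam : nat -> R),
    forall k (g : X -> R), continuous g -> bounded_fun g ->
      transfer_dual (fun t k => phi k t) k (m k.+1) g =
        ((lam k)%:E * \int[m k]_t (g t)%:E)%E.
Proof.
have [m [lam mP]] := conformal_measures.
exists m, lam => k g cg [M [_ /(_ (M + 1)) gM]].
have {}gM t : `|g t| <= M + 1 by apply: gM => //; rewrite ltrDl.
have max0 (x : R) : 0 <= Num.max x 0 by rewrite le_max lexx orbT.
pose gp t := Num.max (g t) 0; pose gm t := Num.max (- g t) 0.
have cmax (h : X -> R) : continuous h -> continuous (fun t => Num.max (h t) 0).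
  move=> ch t.
  have := @continuous_max _ _ h (cst 0) t (ch t) (@cst_continuous X R 0 t).
  exact.
have cgp : continuous gp by exact: cmax.
have cgm : continuous gm.
  by apply: (cmax (fun t => - g t)) => t; apply: continuousN; exact: cg.
have gpM t : 0 <= gp t <= M + 1.
  rewrite max0/= ge_max (le_trans (ler_norm _) (gM t))/=.
  by rewrite (le_trans (normr_ge0 (g t))).
have gmM t : 0 <= gm t <= M + 1.
  rewrite max0/= ge_max (le_trans (ler_norm _))/= ?normrN//.
  by rewrite (le_trans (normr_ge0 (g t))).
have int_fin (h : X -> R) j : continuous h -> (forall t, 0 <= h t <= M + 1) ->
    (\int[m j]_t (h t)%:E)%E \is a fin_num.
  move=> ch hM; apply: integrable_fin_num => //.
  apply: (@le_integrable _ B R (m j) setT measurableT _ (EFin \o cst (M + 1))).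
  - by apply/measurable_EFinP; exact: continuous_shift_measurable.
  - move=> t _; have /andP[h0 hM1] := hM t.
    by rewrite /= lee_fin !ger0_norm// (le_trans h0).
  - exact: finite_measure_integrable_cst.
(* The identity of [conformal_measures] itself makes the integral finite, so the difference of the
   two parts can be integrated. *)
have rint (h : X -> R) : continuous h -> (forall t, 0 <= h t <= M + 1) ->
    (m k.+1).-integrable [set: B] (L k (EFin \o h)).
  move=> ch hM; have h0 t : (0 <= (h t)%:E)%E by have /andP[] := hM t.
  have r0 t : (0 <= L k (EFin \o h) t)%E.
    by apply: ruelle_ge0 => // *; exact: weight_ge0.
  apply/integrableP; split.
    by apply: measurable_ruelle => // t; have /andP[] := hM t.
  under eq_integral do rewrite gee0_abs//.
  by rewrite (mP k h (M + 1))// ltey_eq fin_numM// int_fin.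
pose r h : B -> \bar R := L k (EFin \o h).
have -> : transfer_dual (fun t k => phi k t) k (m k.+1) g =
    (\int[m k.+1]_t (r gp \- r gm) t)%E.
  by apply: eq_integral => t _; rewrite transferE.
rewrite integralB//; try exact: rint.
rewrite (mP k gp (M + 1))// (mP k gm (M + 1))// -muleBr//; last first.
  by rewrite fin_num_adde_defr// int_fin.
congr (_ * _)%E; rewrite [RHS]integralE.
congr (_ - _)%E; apply: eq_integral => t _.
  by rewrite funeposE -EFin_max.
by rewrite funenegE -EFinN -EFin_max.
Qed.

End ConformalSequence.

(** * Conformal measures along a forward orbit *)

Unset Implicit Arguments.
Set Strict Implicit.

Theorem theorem2p14 (R : realType) (E : countType) (hE : inhabited E)
    (A : rel E) (hA : finitely_primitive A)
    (d : measure_display) (Omega : measurableType d) (P : probability Omega R)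
    (hP : measure_is_complete P) (theta : Omega -> Omega)
    (htheta : ergodic_automorphism P theta)
    (gamma : R) (hgamma : 0 < gamma)
    (f : shift_space R A -> Omega -> R) (hf : holder_potential P gamma f)
    (w : Omega) (hw : (Omega_d P theta gamma f `&` Omega_b theta f) w) :
  exists m : nat -> probability (borel_shift R hE hA) R,
    forall k : nat,
      let lambda := transfer_dual f (iter k theta w) (m k.+1) (cst 1) in
      forall g : shift_space R A -> R, continuous g -> bounded_fun g ->
        transfer_dual f (iter k theta w) (m k.+1) g =
        (lambda * \int[m k]_t (g t)%:E)%E.
Proof.
pose phi k t := f t (iter k theta w).
(* The Hoelder constant of the fibre itself, finite by [potential_holder]. *)
pose V k := fine (holder gamma (phi k)).
have holder_ge0 k : (0 <= holder gamma (phi k))%E.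
  by apply: ereal_sup_ubound; left.
have VE k : holder gamma (phi k) = (V k)%:E.
  rewrite /V fineK// ge0_fin_numE//; exact: (potential_holder hf).
have V0 k : 0 <= V k by exact: fine_ge0.
have phi_holder k (s t : shift_space R A) : s <> t -> s 0%N = t 0%N ->
    `|phi k s - phi k t| <= V k * sdist s t `^ gamma.
  move=> st st0; rewrite -ler_pdivrMr; last first.
    rewrite powR_gt0// lt_neqAle sdist_ge0 andbT eq_sym.
    by apply/eqP => /sdist_positivity.
  by rewrite -lee_fin -VE; apply: ereal_sup_ubound; right; exists s, t.
have phi_cts k : continuous (phi k) by exact: (potential_continuous hf).
have sum_fin k t : (\sum_(i <oo) (weight (phi k) i t)%:E < +oo)%E.
  have : (transfer_sup f (iter k theta w) < +oo)%E.
    (* Membership of [w] in the preimage under [iter k.+1 theta], indexed by [Negz k], is the bound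
       at the forward iterate; the base fibre uses the index 0. *)
    case: k => [|k].
      by have [_ /(_ (Posz 0) I)[w' /= + <-]] := hw.
    by have [_ /(_ (Negz k) I)] := hw.
  apply: le_lt_trans; apply: ereal_sup_ubound; exists t => //.
  rewrite -[LHS]/(transfer (fun t k => phi k t) k (cst 1) t) transferE.
  rewrite [X in (_ - X)%E](_ : _ = 0%E) ?sube0.
    by apply: eq_eseriesr => i _; rewrite /= (max_idPl _)// mule1.
  by apply: eseries0 => i _ _; rewrite (max_idPr _) ?oppr_le0// mule0.
have [m [lam mP]] :=
  conformal_sequence hE hA hgamma V0 phi_holder phi_cts sum_fin.
exists m => k lambda g cg bg.
(* Testing with the constant 1 identifies the factor, since [m k] has total mass 1. *)
have -> : lambda = (lam k)%:E.
  rewrite /lambda.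
  rewrite -[LHS]/(transfer_dual (fun t k => phi k t) k (m k.+1) (cst 1)).
  rewrite mP; [|exact: cst_continuous|exact: bounded_cst].
  rewrite -[X in (_ * X)%E]/(\int[m k]_t cst 1%:E t)%E.
  have mT : m k setT = 1%E := probability_setT (m k).
  by rewrite integral_cst// [X in (_ * (_ * X))%E]mT !mule1.
exact: mP.
Qed.
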